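(* Let $p$ be an odd prime, $m,s$ positive integers, and $\mathcal{R}=\mathbb{F}_{p^m}[u,v]/\langle u^2,v^2,uv-vu\rangle$. Let $\alpha=\alpha_1+\alpha_2u+\alpha_3v+\alpha_4uv\in\mathcal{R}$ with $\alpha_1,\alpha_2,\alpha_3\in\mathbb{F}_{p^m}^*$, $\alpha_4\in\mathbb{F}_{p^m}$, and suppose $\alpha$ is not a square in $\mathcal{R}$. Let $\alpha_0\in\mathbb{F}_{p^m}$ be the element with $\alpha_0^{p^s}=\alpha_1$. Let $\mathcal{C}=\langle (x^2-\alpha_0)^\ell+u(x^2-\alpha_0)^tz(x)\rangle$ be the ideal of $\mathcal{R}_\alpha=\mathcal{R}[x]/\langle x^{2p^s}-\alpha\rangle$, where $0\le\ell\le 2p^s-1$, $0\le t<\ell$, and $z(x)$ is $0$ or a unit. Let $\Im$ be the smallest non-negative integer such that $u(x^2-\alpha_0)^{\Im}\in\mathcal{C}$. Then the Hamming distance of $\mathcal{C}$ is $$d_H(\mathcal{C})=\begin{cases}1 & \text{if } 0\le\Im\le p^s;\\ (\Gamma+1)p^{\gamma} & \text{if } 2p^s-p^{s-\gamma}+(\Gamma-1)p^{s-\gamma-1}+1\le\Im\le 2p^s-p^{s-\gamma}+\Gamma p^{s-\gamma-1},\\ & \text{where } 1\le\Gamma\le p-1 \text{ and } 0\le\gamma\le s-1.\end{cases}$$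
   Context: Elements of $\mathcal{R}_\alpha=\mathcal{R}[x]/\langle x^{2p^s}-\alpha\rangle$ are identified with vectors in $\mathcal{R}^{2p^s}$: the class whose representative of degree less than $2p^s$ is $\zeta_0+\zeta_1x+\cdots+\zeta_{2p^s-1}x^{2p^s-1}$ corresponds to $(\zeta_0,\ldots,\zeta_{2p^s-1})$. Ideals of $\mathcal{R}_\alpha$ are thereby the $\alpha$-constacyclic codes of length $2p^s$ over $\mathcal{R}$. The Hamming weight of a vector is the number of its nonzero entries, and the Hamming distance $d_H(\mathcal{C})$ of a nonzero linear code is the minimum Hamming weight of its nonzero codewords. When $z(x)$ is a unit, it is represented as a finite sum $z(x)=\sum_{\kappa}(z_{0\kappa}x+z_{1\kappa})(x^2-\alpha_0)^\kappa$ with $z_{0\kappa},z_{1\kappa}\in\mathbb{F}_{p^m}$ and $z_{00}x+z_{10}\ne0$. *)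

(* Defs.v *)
From HB Require Import structures.
From mathcomp Require Import all_boot all_order all_algebra.
From mathcomp Require Import generic_quotient ring_quotient qpoly.
From mathcomp Require Import boolp.

Set Implicit Arguments.
Unset Strict Implicit.
Unset Printing Implicit Defensive.

Import GRing.Theory.
Local Open Scope ring_scope.
Local Open Scope quotient_scope.

(* boolp is only used to make ideal membership boolean, via `[< P >].
   F[u, v] is {poly {poly F}}: the inner variable is u, the outer one is v. *)
Definition biU (F : fieldType) : {poly {poly F}} := 'X%:P.
Definition biV (F : fieldType) : {poly {poly F}} := 'X.

Definition uvIdeal (F : fieldType) : {pred {poly {poly F}}} :=
  fun P => `[< exists a b c : {poly {poly F}},
    P = a * biU F ^+ 2 + b * biV F ^+ 2
        + c * (biU F * biV F - biV F * biU F) >].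

Lemma uvIdeal_closed (F : fieldType) : idealr_closed (@uvIdeal F).
Proof.
split.
- by apply/asboolP; exists 0, 0, 0; rewrite !mul0r !addr0.
- apply/negP => /asboolP[a [b [c]]].
  move/(congr1 (fun P : {poly {poly F}} => P`_0`_0)).
  rewrite /biU /biV (mulrC 'X) subrr mulr0 addr0 -polyC_exp.
  rewrite coefD coefMC coefMXn /= addr0 coefMXn /= !coef1 => /eqP.
  by rewrite oner_eq0.
move=> r P Q /asboolP[a [b [c ->]]] /asboolP[a' [b' [c' ->]]].
apply/asboolP; exists (r * a + a'), (r * b + b'), (r * c + c').
move: (biU F ^+ 2) (biV F ^+ 2) (biU F * biV F - biV F * biU F) => X Y Z.
by rewrite !mulrDr !mulrDl !mulrA [LHS]addrACA; congr (_ + _); rewrite addrACA.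
Qed.

HB.instance Definition _ (F : fieldType) :=
  isIdealr.Build {poly {poly F}} (@uvIdeal F) (uvIdeal_closed F).

(* F[u, v] / <u^2, v^2, uv - vu> *)
Notation uvRing F := {ideal_quot (@uvIdeal F)}.

Section Ring.
Variable F : fieldType.
Definition uvC (a : F) : uvRing F := \pi_(uvRing F) (a%:P%:P).
Definition uvU : uvRing F := \pi_(uvRing F) (biU F).
Definition uvV : uvRing F := \pi_(uvRing F) (biV F).
Definition uvElt (a1 a2 a3 a4 : F) : uvRing F :=
  uvC a1 + uvC a2 * uvU + uvC a3 * uvV + uvC a4 * (uvU * uvV).
End Ring.
Arguments uvU : clear implicits.
Arguments uvV : clear implicits.

(* A[x] / <x^n - a>.  For n > 0 the modulus is monic of degree n, so that
   qpoly represents a class by its unique representative of degree < n; for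
   n = 0 qpoly would silently quotient by 'X instead. *)
Notation constacyclic n a := {poly %/ ('X^n - a%:P)}.

Section Codes.
Variables (A : comNzRingType) (n : nat) (a : A).
Implicit Types (c g : constacyclic n a) (C : constacyclic n a -> Prop).

Definition principal_ideal g : constacyclic n a -> Prop :=
  fun c => exists r : constacyclic n a, c = r * g.

Definition codeword c : 'rV[A]_n := \row_(i < n) c`_i.

Definition hamming_weight (w : 'rV[A]_n) : nat := #|[set i | w 0 i != 0]|.

Definition is_hamming_distance C (d : nat) : Prop :=
  (exists c, [/\ C c, c != 0 & hamming_weight (codeword c) = d]) /\
  (forall c, C c -> c != 0 -> (d <= hamming_weight (codeword c))%N).

Definition is_unit c : Prop := exists c' : constacyclic n a, c * c' = 1.
End Codes.

Section Generator.
Variables (F : fieldType) (n : nat) (a : uvRing F).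

Definition linC (b0 b1 : F) : constacyclic n a :=
  uvC b0 *: qpolyX ('X^n - a%:P) + (uvC b1)%:A.

Definition quadC (a0 : F) : constacyclic n a :=
  qpolyX ('X^n - a%:P) ^+ 2 - (uvC a0)%:A.

(* A unit z is taken in the form sum_k (z0_k x + z1_k) (x^2 - a0)^k with
   coefficients in F and z0_0 x + z1_0 <> 0. *)
Definition zero_or_unit (a0 : F) (z : constacyclic n a) : Prop :=
  z = 0 \/
  is_unit z /\
  exists (N : nat) (z0 z1 : nat -> F),
    linC (z0 0%N) (z1 0%N) != 0 /\
    z = \sum_(k < N.+1) linC (z0 k) (z1 k) * quadC a0 ^+ k.

End Generator.
Arguments linC {F} n a b0 b1.
Arguments quadC {F} n a a0.
Arguments zero_or_unit {F} n a a0 z.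

(* Main.v *)
(* Put y = x^2 - a0.  Then y^(p^s) = a2 u + a3 v + a4 uv, so that
   u y^(p^s) = a3 uv and u y^(2 p^s) = 0.  A nonzero codeword c can be replaced,
   without increasing its weight, by u c or (if u c = 0) by itself; it then lies
   in <u>, i.e. it is u B(x) with B over F.  As alpha is not a square, x^2 - a0
   is irreducible, whence y^Im divides B by minimality of Im.  If Im <= p^s the
   code contains the nonzero constant a3 uv.  Otherwise everything reduces to
   the weights of the multiples of (x^2 - a0)^(Im - p^s) of degree < 2 p^s in
   F[x].

   Such weights are bounded below one base-p digit at a time.  Write
   f = (X^q - b)^e f' with q = p^(s-1), b = a^q and g = f' mod (X^q - b) <> 0.
   For each i with g_i <> 0, the coefficients of f with index i mod q form a
   nonzero polynomial of degree < p divisible by (Z - b)^e, hence with at least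
   e + 1 terms; so f has at least (e + 1) wt(g) terms, and one recurses on g.
   The bound is attained by powers of x^2 - a0, which factor into few-term
   polynomials by the Frobenius. *)
From HB Require Import structures.
Require Import Defs.
From mathcomp Require Import all_boot all_order all_algebra.
From mathcomp Require Import generic_quotient ring_quotient qpoly.
From mathcomp Require Import boolp zify ring.

Set Implicit Arguments.
Unset Strict Implicit.
Unset Printing Implicit Defensive.

Import GRing.Theory.
Local Open Scope ring_scope.

(** * Weights of polynomials, and their splitting by residues of exponents *)

Definition weight (R : nzRingType) (f : {poly R}) : nat :=
  count (predC1 0) f.

Section WeightRing.
Variable R : comNzRingType.
Implicit Types f g : {poly R}.

Lemma weight_sum N f :
  (size f <= N)%N -> weight f = (\sum_(i < N) (f`_i != 0)%R)%N.
Proof.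
move=> fN; rewrite /weight -sum1_count (big_nth 0) big_mkord.
rewrite (big_ord_widen_cond N (fun i => f`_i != 0) (fun=> 1%N)) // big_mkcond
  /=.
apply: eq_bigr => i _; case: (ltnP i (size f)) => fi; first by rewrite andbT;
  case: eqP.
by rewrite andbF nth_default // eqxx.
Qed.

Lemma weight0 : weight (0 : {poly R}) = 0%N.
Proof. by rewrite /weight polyseq0. Qed.

Lemma weight_gt0 f : (0 < weight f)%N = (f != 0).
Proof.
have [->|f0] := eqVneq f 0; first by rewrite weight0.
rewrite -has_count; apply/hasP; exists (lead_coef f); last by rewrite /=
  lead_coef_eq0.
by rewrite lead_coefE mem_nth // prednK ?size_poly_gt0.
Qed.

Lemma weightD f g : (weight (f + g) <= weight f + weight g)%N.
Proof.
pose N := maxn (size f) (size g).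
rewrite !(@weight_sum N) ?leq_maxl ?leq_maxr ?size_polyD // -big_split /=.
apply: leq_sum => i _; rewrite coefD.
by case: (eqVneq f`_i 0) => [->|_]; [rewrite add0r | exact: leq_trans (leq_b1
  _) (leq_addr _ _)].
Qed.

Lemma weight_big I (r : seq I) (E : I -> {poly R}) :
  (weight (\sum_(i <- r) E i) <= \sum_(i <- r) weight (E i))%N.
Proof.
elim: r => [|i r IH]; first by rewrite !big_nil weight0.
by rewrite !big_cons (leq_trans (weightD _ _)) ?leq_add2l.
Qed.

Lemma weightMXn f n : weight (f * 'X^n) = weight f.
Proof.
have [->|f0] := eqVneq f 0; first by rewrite mul0r.
by rewrite /weight polyseqMXn // -cat_nseq count_cat count_nseq /= eqxx mul0n.
Qed.

Lemma weightZ a f : (weight (a *: f) <= (a != 0)%R * weight f)%N.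
Proof.
have [->|a0] := eqVneq a 0; first by rewrite scale0r weight0.
rewrite mul1n !(@weight_sum (size f)) ?size_scale_leq //; apply: leq_sum => i _.
by rewrite coefZ; case: (eqVneq f`_i 0) => [->|_]; rewrite ?mulr0 ?eqxx //;
  exact: leq_b1.
Qed.

Lemma weightM f g : (weight (f * g) <= weight f * weight g)%N.
Proof.
rewrite -[X in X * g]coefK poly_def mulr_suml.
rewrite (leq_trans (weight_big _ _)) // (@weight_sum (size f) f) // big_distrl
  /=.
apply: leq_sum => i _.
by rewrite -scalerAl mulrC (leq_trans (weightZ _ _)) // weightMXn.
Qed.

Lemma weight_binomial c a r : (weight (('X^c - a%:P : {poly R}) ^+ r) <=
  r.+1)%N.
Proof.
rewrite exprBn (leq_trans (weight_big _ _)) //.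
rewrite -[X in (_ <= X)%N]card_ord -sum1_card; apply: leq_sum => i _.
rewrite -exprM.
set P := _ *+ _.
have -> : P = ((- 1) ^+ i * a ^+ i *+ 'C(r, i)) *: (1 * 'X^(c * (r - i))).
  rewrite /P mul1r -mul_polyC -[in RHS]mulr_natr !rmorphM !rmorphXn rmorphN1
    rmorph_nat.
  by rewrite -mulr_natr; ring.
rewrite (leq_trans (weightZ _ _)) // weightMXn.
by rewrite /weight polyseq1 /= oner_eq0 muln1 leq_b1.
Qed.

Lemma sum_ordM (q M : nat) (E : nat -> nat) :
  (\sum_(n < M * q) E n = \sum_(i < q) \sum_(d < M) E (i + q * d)%N)%N.
Proof.
elim: M => [|M IH]; first by rewrite mul0n big_ord0 big1 // => i _; rewrite
  big_ord0.
rewrite mulSnr big_split_ord /= IH -big_split /=; apply: eq_bigr => i _.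
by rewrite big_ord_recr /= [(M * q)%N]mulnC [(_ + i)%N]addnC.
Qed.

(** For [i < q], this is the component of [f] on ['X^i] over the polynomials in ['X^q], with ['X^q]
    renamed ['X]. The bound [size f] is generous: when [q > 0], all coefficients beyond it
    vanish. *)
Definition decimate (q i : nat) f : {poly R} := \poly_(d < size f) f`_(i + q *
  d).

Lemma coef_decimate q i f d : (0 < q)%N -> (decimate q i f)`_d = f`_(i + q * d).
Proof.
move=> q0; rewrite coef_poly; case: ltnP => // fd.
by rewrite nth_default // (leq_trans fd) // (leq_trans _ (leq_addl _ _)) //
  leq_pmull.
Qed.

Lemma decimateD q i f g : (0 < q)%N ->
  decimate q i (f + g) = decimate q i f + decimate q i g.
Proof. by move=> q0; apply/polyP => d; rewrite !(coefD, coef_decimate). Qed.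

Lemma size_decimate q i f M : (0 < q)%N ->
  (size f <= M * q)%N -> (size (decimate q i f) <= M)%N.
Proof.
move=> q0 fM; apply/leq_sizeP => d Md.
by rewrite coef_decimate // nth_default // (leq_trans fM) // mulnC (leq_trans _
  (leq_addl _ _)) // leq_mul.
Qed.

Lemma weight_decimate q f : (0 < q)%N ->
  weight f = (\sum_(i < q) weight (decimate q i f))%N.
Proof.
move=> q0; rewrite (@weight_sum (size f * q) f) ?leq_pmulr //.
rewrite (sum_ordM q (size f) (fun n => (f`_n != 0)%R)).
apply: eq_bigr => i _; rewrite (@weight_sum (size f)) ?size_poly //.
by apply: eq_bigr => d _; rewrite coef_decimate.
Qed.

(** Multiplication by a polynomial in ['X^q] acts on each residue class of exponents separately. *)
Lemma decimate_XnsubC_exp q i b e f : (i < q)%N ->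
  decimate q i (('X^q - b%:P) ^+ e * f) = ('X - b%:P) ^+ e * decimate q i f.
Proof.
move=> iq; have q0 : (0 < q)%N by apply: leq_trans iq.
elim: e => [|e IH]; first by rewrite !expr0 !mul1r.
rewrite !exprS -!mulrA -IH; move: (_ * f) => g.
apply/polyP => d; rewrite coef_decimate // !mulrBl !coefB !coefCM coefXnM
  coefXM.
rewrite !coef_decimate //; congr (_ - _).
case: d => [|d]; first by rewrite muln0 addn0 iq.
by rewrite mulnS addnCA -[(_ < _)%N]negbK -leqNgt leq_addr /= addKn.
Qed.

End WeightRing.

(** * Weight bounds for multiples and powers of binomials in characteristic [p] *)

Lemma dvdp_exp_max (F : fieldType) (h f : {poly F}) : (1 < size h)%N -> f != 0
  ->
  exists e (g : {poly F}), f = h ^+ e * g /\ ~~ (h %| g).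
Proof.
move=> h1; have [N] := ubnP (size f); elim: N f => // N IH f fN f0.
have [/dvdpP[g fg]|hf] := boolP (h %| f); last by exists 0%N, f; rewrite expr0
  mul1r.
have g0 : g != 0 by apply: contraNneq f0 => g0; rewrite fg g0 mul0r.
have h0 : h != 0 by rewrite -size_poly_gt0 (leq_trans _ h1).
case: (IH g) => //.
  by move: fN h1; rewrite fg size_mul //; move: (size g) (size h) => x y; lia.
move=> e [g' [gg' hg']]; exists e.+1, g'; split=> //.
by rewrite fg gg' exprSr; ring.
Qed.

Section WeightField.
Variables (F : fieldType) (p : nat).
Hypothesis pcharF : p \in [pchar F].
Implicit Types f g : {poly F}.

(* Induction on [e]: with [c] the degree of [f], the operator ['X d/d'X - c]
   lowers the order of vanishing at [b] by at most one and, as [size f <= p],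
   kills exactly the leading monomial. *)
Lemma weight_dvd_XsubC_exp b e f : b != 0 -> f != 0 -> (size f <= p)%N ->
  ('X - b%:P) ^+ e %| f -> (e < weight f)%N.
Proof.
move=> b0; elim: e f => [|e IH] f f0 fp fe; first by rewrite weight_gt0.
pose c := (size f).-1.
have f1 : (0 < size f)%N by rewrite size_poly_gt0.
have cE : (c.+1 = size f)%N by rewrite prednK.
have fc : f`_c != 0 by rewrite -lead_coefE lead_coef_eq0.
pose g := 'X * f^`() - c%:R *: f.
have gE i : g`_i = (i%:R - c%:R) * f`_i.
  rewrite coefB coefXM coefZ mulrBl; congr (_ - _).
  by case: i => [|i] /=; rewrite ?mul0r // coef_deriv mulr_natl.
have gp : (size g <= p)%N.
  by apply/leq_sizeP => i pi; rewrite gE nth_default ?mulr0 // (leq_trans fp).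
have gdvd : ('X - b%:P) ^+ e %| g.
  case/dvdpP: (fe) => h fh; rewrite /g fh derivM deriv_exp derivXsubC mul1r.
  apply/dvdpP; exists ('X * (h^`() * ('X - b%:P) + h * e.+1%:R) - c%:R *: (h *
    ('X - b%:P))).
  rewrite -!mul_polyC exprS /= -[_ ^+ _ *+ _]mulr_natr.
  move: ('X - b%:P) (e.+1%:R : {poly F}) (c%:R%:P) h^`() => D k c' h'.
  move: 'X (D ^+ e) => X W.
  by ring.
have wfg : (weight g < weight f)%N.
  have gs : (size g <= size f)%N.
    by apply/leq_sizeP => i fi; rewrite gE nth_default ?mulr0.
  rewrite (@weight_sum _ (size f) g) // (@weight_sum _ (size f) f) //.
  rewrite -cE !big_ord_recr /= gE subrr mul0r eqxx fc addn0 addn1 ltnS.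
  apply: leq_sum => i _; rewrite gE.
  by case: (eqVneq f`_i 0) => [->|_]; rewrite ?mulr0 ?eqxx ?leq_b1.
apply: leq_trans wfg; rewrite ltnS.
apply: IH => //; apply/eqP => g0.
(* If [g = 0], then [f] is a monomial, since [i - c] is nonzero in [F] for [i < c < p]; a monomial
   cannot vanish at [b != 0]. *)
have fX : f = f`_c *: 'X^c.
  apply/polyP => i; rewrite coefZ coefXn.
  have [->|ic] := eqVneq i c; first by rewrite mulr1.
  rewrite mulr0; have [fi|fi] := leqP (size f) i; first by rewrite nth_default.
  have /eqP := gE i; rewrite g0 coef0 eq_sym mulf_eq0 => /orP[|/eqP//].
  have ltic : (i < c)%N by rewrite ltn_neqAle ic -ltnS cE.
  rewrite subr_eq0 eq_sym -subr_eq0 -natrB ?(ltnW ltic) // -(dvdn_pcharf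
    pcharF).
  have ci0 : (0 < c - i)%N by rewrite subn_gt0.
  move=> /(dvdn_leq ci0); rewrite leqNgt => /negP[].
  by rewrite (leq_ltn_trans (leq_subr _ _)) // cE.
have : root f b by rewrite root_factor_theorem (dvdp_trans _ fe) // exprS
  dvdp_mulr.
by rewrite fX rootE !hornerE (negPf (mulf_neq0 _ _)) // expf_neq0.
Qed.

(** Reduction modulo ['X^q - b%:P] replaces each component of [f] by its value at [b]. A nonzero
    coefficient of the remainder thus comes from a nonzero component, whose product with
    [('X - b%:P) ^+ e] has more than [e] terms. *)
Lemma weight_XnsubC_exp (b : F) q e f : b != 0 -> (0 < q)%N ->
  (size (('X^q - b%:P) ^+ e * f)%R <= p * q)%N ->
  (e.+1 * weight (f %% ('X^q - b%:P)) <= weight (('X^q - b%:P) ^+ e * f))%N.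
Proof.
move=> b0 q0 fpq; set W := 'X^q - b%:P in fpq *; set g := f %% W.
have W0 : W != 0 by rewrite -size_poly_gt0 size_XnsubC.
have gq : (size g <= q)%N by rewrite -ltnS -(size_XnsubC b q0) ltn_modp.
rewrite (@weight_sum _ q g) // (weight_decimate _ q0) big_distrr /=.
apply: leq_sum => i _; case: (eqVneq g`_i 0) => [_|gi]; first by rewrite muln0.
rewrite muln1; apply: (weight_dvd_XsubC_exp b0); last 1 first.
- by rewrite decimate_XnsubC_exp ?dvdp_mulr.
- rewrite decimate_XnsubC_exp // mulf_neq0 ?expf_neq0 ?polyXsubC_eq0 //.
  rewrite [f](divp_eq _ W) -/g decimateD // [_ * W]mulrC -[W]expr1
    decimate_XnsubC_exp // expr1.
  apply/eqP => /(congr1 (horner^~ b)) /eqP.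
  rewrite !hornerE subrr mul0r add0r.
  have -> : decimate q i g = (g`_i)%:P.
    apply/polyP => d; rewrite coef_decimate // coefC.
    case: d => [|d]; first by rewrite muln0 addn0.
    by rewrite nth_default // (leq_trans gq) // mulnS addnCA leq_addr.
  by rewrite hornerC (negPf gi).
- exact: size_decimate.
Qed.

Lemma XnsubC_exp_pchar (a : F) c s :
  ('X^c - a%:P) ^+ (p ^ s) = 'X^(c * p ^ s) - (a ^+ (p ^ s))%:P.
Proof.
have pnat_ps : [pchar {poly F}].-nat (p ^ s)%N.
  rewrite (eq_pnat _ (pchar_poly F)) (eq_pnat _ (pcharf_eq pcharF)).
  by rewrite pnatX pnat_id // (pcharf_prime pcharF).
by rewrite exprDn_pchar // exprNn_pchar // exprM rmorphXn.
Qed.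

(* [G] stands for the paper's [Gamma - 1], here and below. *)
Lemma weight_lower_bound (s g G j : nat) (a : F) f :
  a != 0 -> f != 0 -> (size f <= p ^ s)%N -> ('X - a%:P) ^+ j %| f ->
  (g < s)%N -> (G.+1 < p)%N ->
  (p ^ s - p ^ (s - g) + G * p ^ (s - g.+1) < j)%N ->
  (G.+2 * p ^ g <= weight f)%N.
Proof.
have p_pr : prime p := pcharf_prime pcharF.
have p0 : (0 < p)%N := prime_gt0 p_pr.
move=> a0; elim: s g G j f => // s IH g G j f f0 fs fj gs Gp Tj.
have [q qE] : {q : nat | q = (p ^ s)%N} by exists (p ^ s)%N.
have q0 : (0 < q)%N by rewrite qE expn_gt0 p0.
pose b := a ^+ q; have b0 : b != 0 by rewrite expf_neq0.
pose L := 'X - a%:P; pose W := 'X^q - b%:P.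
have WE : W = L ^+ q.
  by rewrite /W /b /L -['X in RHS]expr1 qE XnsubC_exp_pchar mul1n.
have sW : size W = q.+1 by rewrite size_XnsubC.
have L0 : L != 0 by rewrite polyXsubC_eq0.
have W0 : W != 0 by rewrite -size_poly_gt0 sW.
have [e [f' [ff' Wf']]] : exists e f', f = W ^+ e * f' /\ ~~ (W %| f').
  by apply: dvdp_exp_max; rewrite ?sW // ltnS.
pose h := f' %% W; have h0 : h != 0 by apply: contra Wf' => /eqP/modp_eq0P.
have hq : (size h <= q)%N by rewrite -ltnS -sW ltn_modp.
have wf : (e.+1 * weight h <= weight f)%N.
  by rewrite ff'; apply: weight_XnsubC_exp; rewrite // -ff' (leq_trans fs) //
    expnS qE.
have Lf' : L ^+ (j - q * e) %| f'.
  by rewrite -dvdp_exp_sub // mulrC exprM -WE -ff'.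
have je : (j < q * e.+1)%N.
  rewrite ltnNge; apply: contra Wf' => je.
  have qj : (q <= j - q * e)%N by rewrite mulnS in je; clear -je; lia.
  by rewrite WE; apply: dvdp_trans Lf'; apply: dvdp_exp2l.
(* The leftover exponent is at most [q], so this power divides [W = L ^+ q] and survives reduction
   modulo [W]. *)
have Lh : L ^+ (j - q * e) %| h.
  rewrite /h -(dvdp_addr _ (_ : L ^+ (j - q * e) %| f' %/ W * W)) -?divp_eq //.
  have jq : (j - q * e <= q)%N by rewrite mulnS in je; clear -je; lia.
  by rewrite dvdp_mull // WE; apply: dvdp_exp2l.
have ep : (e < p)%N.
  have f'0 : f' != 0 by apply: contraNneq f0 => f'0; rewrite ff' f'0 mulr0.
  have : (size (W ^+ e) <= size f)%N by rewrite dvdp_leq // ff' dvdp_mulr.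
  rewrite WE -exprM size_exp_XsubC => /leq_trans/(_ fs).
  by rewrite expnSr -qE ltn_pmul2l.
(* For [g = 0] the threshold reads [G * q < j], whence [G <= e]. If [e = G], a positive power of [L]
   still divides [h], so [h] has the nonzero root [a] and at least two terms. *)
case: g gs Tj => [|g] gs Tj.
  move: Tj; rewrite subn0 subnn add0n subSS subn0 -qE => Tj.
  have Ge : (G <= e)%N.
    by rewrite -ltnS -(ltn_pmul2l q0) (leq_ltn_trans _ je) // mulnC ltnW.
  apply: leq_trans wf; have [Ge'|eG] := ltnP G e.
    by rewrite expn0 muln1 (leq_trans _ (leq_pmulr _ _)) // weight_gt0.
  have Ee : e = G by apply/eqP; rewrite eqn_leq Ge eG.
  suff w2 : (1 < weight h)%N.
    by rewrite Ee; apply: leq_trans (leq_mul (leqnn _) w2); rewrite expn0;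
      clear; lia.
  case: (posnP s) => [s0|s0].
    by move: je Tj; rewrite Ee qE s0 expn0 mul1n muln1 ltnS leqNgt => /negP.
  rewrite qE in hq.
  have := IH 0%N 0%N _ _ h0 hq Lh s0 (prime_gt1 p_pr).
  rewrite subn0 subnn mul0n subn_gt0 expn0 muln1 Ee [(q * G)%N]mulnC; exact.
(* For larger [g] the threshold is at least [(p - 1) * q], which forces [e = p - 1]: a factor [p] is
   gained and the rest of the exponent passes to [h]. *)
move: Tj; rewrite ltnS in gs; rewrite !subSS => Tj.
have qg : (p ^ (s - g) <= q)%N by rewrite qE leq_exp2l ?prime_gt1 // leq_subr.
have pe : (e.+1 = p)%N.
  apply/eqP; rewrite eqn_leq ep /= -ltnS -(ltn_pmul2l q0).
  move: Tj je qg; rewrite expnSr -qE; move: (G * _)%N (p ^ _)%N => x y.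
  by clear; nia.
rewrite qE in hq; rewrite expnS mulnCA -{1}pe (leq_trans _ wf) // leq_mul2l /=.
apply: IH h0 hq Lh gs Gp _.
move: Tj qg; rewrite expnSr -qE -{1}pe mulnS.
move: (G * _)%N (p ^ _)%N => x y; clear; nia.
Qed.

(** One nonzero component modulo [c] suffices: it has size at most [p ^ s] and is divisible by
    [('X - a%:P) ^+ j]. *)
Lemma weight_lower_bound_Xn (c s g G j : nat) (a : F) f :
  (0 < c)%N -> a != 0 -> f != 0 -> (size f <= c * p ^ s)%N ->
  ('X^c - a%:P) ^+ j %| f -> (g < s)%N -> (G.+1 < p)%N ->
  (p ^ s - p ^ (s - g) + G * p ^ (s - g.+1) < j)%N ->
  (G.+2 * p ^ g <= weight f)%N.
Proof.
move=> c0 a0 f0 fs /dvdpP[h fh] gs Gp Tj.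
have [i] : exists i : 'I_c, decimate c i f != 0.
  have : (0 < weight f)%N by rewrite weight_gt0.
  rewrite (weight_decimate _ c0) lt0n sum_nat_eq0 negb_forall => /existsP[i].
  by rewrite -lt0n weight_gt0; exists i.
move=> fi0; rewrite (weight_decimate _ c0) (bigD1 i) //=.
apply: leq_trans (leq_addr _ _).
apply: weight_lower_bound a0 fi0 _ _ gs Gp Tj.
  by rewrite size_decimate // mulnC.
by rewrite fh mulrC decimate_XnsubC_exp // dvdp_mulr.
Qed.

(** For [G < p] the exponent has base-[p] digits [p - 1] ([g] times), then [G], then zeros. By
    Frobenius, a digit [d] contributes the [d]-th power of a binomial, with at most [d + 1] terms,
    and weights are submultiplicative. *)
Lemma weight_upper_bound (c s g G : nat) (a : F) : (g < s)%N ->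
  (weight (('X^c - a%:P) ^+ (p ^ s - p ^ (s - g) + G * p ^ (s - g.+1)))
    <= G.+1 * p ^ g)%N.
Proof.
have p0 : (0 < p)%N := prime_gt0 (pcharf_prime pcharF).
elim: s g => // s IH [|g] gs.
  rewrite subn0 subnn add0n subSS subn0 expn0 muln1 mulnC exprM
    XnsubC_exp_pchar.
  exact: weight_binomial.
rewrite !subSS ltnS in gs *.
have -> : (p ^ s.+1 - p ^ (s - g) + G * p ^ (s - g.+1) =
  p ^ s * p.-1 + (p ^ s - p ^ (s - g) + G * p ^ (s - g.+1)))%N.
  have : (p ^ (s - g) <= p ^ s)%N by rewrite leq_pexp2l // leq_subr.
  rewrite expnSr; move: (G * _)%N (p ^ _)%N (p ^ s)%N => x y z.
  by clear -p0; nia.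
rewrite exprD (leq_trans (weightM _ _)) // exprM XnsubC_exp_pchar.
rewrite (leq_trans (leq_mul (weight_binomial _ _ _) (IH _ gs))) // prednK //.
by rewrite expnS mulnCA.
Qed.

End WeightField.

(** * Arithmetic of [F[u, v] / <u^2, v^2>] *)

Lemma sqr_uv (A : comNzRingType) (u v e b2 b3 b4 : A) :
  u ^+ 2 = 0 -> v ^+ 2 = 0 ->
  (e + b2 * u + b3 * v + b4 * (u * v)) ^+ 2 =
  e ^+ 2 + 2%:R * e * b2 * u + 2%:R * e * b3 * v
  + (2%:R * e * b4 + 2%:R * b2 * b3) * (u * v).
Proof.
move=> uu vv; apply/eqP; rewrite -subr_eq0; apply/eqP.
transitivity ((b2 + b4 * v) ^+ 2 * u ^+ 2
  + (b3 ^+ 2 + 2%:R * b3 * b4 * u) * v ^+ 2); first by ring.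
by rewrite uu vv !mulr0 addr0.
Qed.

Lemma mul_uv (A : comNzRingType) (u v a b c d : A) : u ^+ 2 = 0 ->
  u * (a + b * u + c * v + d * (u * v)) = a * u + c * (u * v).
Proof.
move=> uu; apply/eqP; rewrite -subr_eq0; apply/eqP.
by transitivity ((b + d * v) * u ^+ 2); [ring | rewrite uu mulr0].
Qed.

Lemma mul_vu (A : comNzRingType) (u v a b c d : A) : v ^+ 2 = 0 ->
  v * (a + b * u + c * v + d * (u * v)) = a * v + b * (u * v).
Proof.
move=> vv; apply/eqP; rewrite -subr_eq0; apply/eqP.
by transitivity ((c + d * u) * v ^+ 2); [ring | rewrite vv mulr0].
Qed.

Lemma mul_v_uv (A : comNzRingType) (u v a c : A) : v ^+ 2 = 0 ->
  v * (a * u + c * (u * v)) = a * (u * v).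
Proof.
move=> vv; apply/eqP; rewrite -subr_eq0; apply/eqP.
by transitivity (c * u * v ^+ 2); [ring | rewrite vv mulr0].
Qed.

Section UVRing.
Variable F : fieldType.
Implicit Types (a b c d : F) (r : uvRing F).
Local Notation u := (uvU F).
Local Notation v := (uvV F).

Lemma uvC_is_zmod_morphism : zmod_morphism (@uvC F).
Proof. by move=> a b; rewrite /uvC !rmorphB. Qed.

Lemma uvC_is_monoid_morphism : monoid_morphism (@uvC F).
Proof. by split=> [|a b]; rewrite /uvC ?rmorph1 // !rmorphM. Qed.

HB.instance Definition _ :=
  GRing.isZmodMorphism.Build F (uvRing F) (@uvC F) uvC_is_zmod_morphism.
HB.instance Definition _ :=
  GRing.isMonoidMorphism.Build F (uvRing F) (@uvC F) uvC_is_monoid_morphism.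

Lemma pi_uv_eq0 (P : {poly {poly F}}) :
  (\pi_(uvRing F)%qT P == 0) = (P \in @uvIdeal F).
Proof. by rewrite -(rmorph0 (\pi_(uvRing F)%qT)) -Quotient.idealrBE subr0. Qed.

Lemma uvU_sqr : u ^+ 2 = 0.
Proof.
apply/eqP; rewrite /uvU -rmorphXn pi_uv_eq0; apply/asboolP.
by exists 1, 0, 0; rewrite !mul0r mul1r !addr0.
Qed.

Lemma uvV_sqr : v ^+ 2 = 0.
Proof.
apply/eqP; rewrite /uvV -rmorphXn pi_uv_eq0; apply/asboolP.
by exists 0, 1, 0; rewrite !mul0r mul1r add0r addr0.
Qed.

Lemma uvC_UV_eq0 a : (uvC a * (u * v) == 0) = (a == 0).
Proof.
apply/eqP/eqP => [|->]; last by rewrite rmorph0 mul0r.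
move/eqP; rewrite /uvC /uvU /uvV -!rmorphM pi_uv_eq0 => /asboolP[A [B [D]]].
rewrite (mulrC (biV F)) subrr mulr0 addr0.
(* The coefficient of [uv] is zero throughout [<u^2, v^2>]. *)
move/(congr1 (fun P : {poly {poly F}} => P`_1`_1)).
rewrite /biU /biV -polyC_exp mulrA -polyCM coefMX coefC /= coefMX coefC /=.
rewrite coefD coefMC. have -> : (B * 'X ^+ 2)`_1 = 0 by rewrite coefMXn.
by rewrite addr0 coefMXn.
Qed.

(** Horner recursion in [u], then in [v]: each multiplication by a variable pushes the old upper
    coefficients into a vanishing square. *)
Lemma uvEltP r : exists a b c d, r = uvElt a b c d.
Proof.
have cP (P : {poly F}) : exists a b, \pi_(uvRing F)%qT P%:P = uvC a + uvC b * u.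
  elim/poly_ind: P => [|P c [a [b IH]]].
    by exists 0, 0; rewrite !rmorph0 mul0r addr0.
  exists c, a; rewrite polyCD polyCM rmorphD rmorphM /= IH -/(uvU F) -/(uvC c).
  by rewrite mulrDl -mulrA -expr2 uvU_sqr mulr0 addr0 addrC.
rewrite -[r]reprK; elim/poly_ind: (repr r) => [|P Q [a [b [c [d IH]]]]].
  by exists 0, 0, 0, 0; rewrite /uvElt !rmorph0 !mul0r !addr0.
case: (cP Q) => e [f Qef]; exists e, f, a, b.
rewrite rmorphD rmorphM /= IH Qef -/(uvV F) [_ * v]mulrC /uvElt mul_vu ?uvV_sqr
  //.
by rewrite addrC addrA.
Qed.

(** The annihilator of [u] is thus contained in [<u>]. Multiplying [u * r] by [v] isolates the
    constant coefficient of [r]; once that is zero, only the coefficient of [v] remains in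
    [u * r]. *)
Lemma annihilator_uvU r :
  u * r = 0 -> exists b d, r = uvC b * u + uvC d * (u * v).
Proof.
case: (uvEltP r) => a [b [c [d ->]]] ur0.
move: ur0; rewrite /uvElt mul_uv ?uvU_sqr // => ur0.
have a0 : a = 0.
  by apply/eqP; rewrite -uvC_UV_eq0 -(mul_v_uv _ _ (uvC c) uvV_sqr) ur0 mulr0.
have c0 : c = 0.
  apply/eqP; rewrite -uvC_UV_eq0; apply/eqP.
  by move: ur0; rewrite a0 rmorph0 mul0r add0r.
by exists b, d; rewrite /uvElt a0 c0 !rmorph0 !mul0r addr0 add0r.
Qed.

(* Square roots lift along the nilpotent ideal [(u, v)] since [2] is a unit. *)
Lemma uvElt_sqr e a2 a3 a4 : e != 0 -> 2%:R != 0 :> F ->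
  exists r, r ^+ 2 = uvElt (e ^+ 2) a2 a3 a4.
Proof.
move=> e0 two0; have e2 : 2%:R * e != 0 by rewrite mulf_neq0.
pose b2 := a2 / (2%:R * e); pose b3 := a3 / (2%:R * e).
pose b4 := (a4 - 2%:R * b2 * b3) / (2%:R * e).
have E2 : 2%:R * e * b2 = a2 by rewrite mulrC divfK.
have E3 : 2%:R * e * b3 = a3 by rewrite mulrC divfK.
have E4 : 2%:R * e * b4 + 2%:R * b2 * b3 = a4 by rewrite [_ * b4]mulrC divfK
  ?subrK.
exists (uvElt e b2 b3 b4); rewrite /uvElt sqr_uv ?uvU_sqr ?uvV_sqr //.
by rewrite -rmorphXn -!(rmorph_nat (@uvC F)) -!rmorphM -rmorphD /= E2 E3 E4.
Qed.

End UVRing.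

(** * The ring [A[x] / <x^n - alpha>] as a space of words *)

Section Constacyclic.
Variables (A : comNzRingType) (n : nat) (alpha : A).
Hypothesis n_gt0 : (0 < n)%N.
Local Notation h := ('X^n - alpha%:P).
Implicit Type c : constacyclic n alpha.

Lemma mk_monic_XnsubC : mk_monic h = h.
Proof. by rewrite /mk_monic size_XnsubC // ltnS n_gt0 monicXnsubC. Qed.

Lemma size_constacyclic c : (size (c : {poly A}) <= n)%N.
Proof.
by have := size_mk_monic c; rewrite [in X in (_ < X)%N]mk_monic_XnsubC
  size_XnsubC.
Qed.

Lemma hamming_weight_codeword c :
  hamming_weight (codeword c) = weight (c : {poly A}).
Proof.
rewrite (weight_sum (size_constacyclic c)) /hamming_weight cardsE -sum1_card.
rewrite big_mkcond; apply: eq_bigr => i _; rewrite unfold_in /= mxE.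
by case: eqP.
Qed.

Lemma in_qpolyC (r : A) : in_qpoly h r%:P = r%:A.
Proof. by rewrite -[r%:P]mulr1 mul_polyC in_qpolyZ in_qpoly1. Qed.

Lemma in_qpolyXn : in_qpoly h 'X^n = alpha%:A.
Proof.
apply/eqP; rewrite -in_qpolyC -subr_eq0 -rmorphB; apply/eqP/val_inj => /=.
by rewrite mk_monic_XnsubC Pdiv.RingMonic.rmodpp // monicXnsubC.
Qed.

Lemma in_qpoly_val c : in_qpoly h c = c.
Proof. by apply: val_inj; exact: in_qpoly_small (size_mk_monic _). Qed.

End Constacyclic.

(** * Ideals and distances over a ring [A] with the needed properties of [uvRing F] *)

Section UVConstacyclic.
Variables (F : fieldType) (A : comNzRingType) (phi : {rmorphism F -> A}).
Variables u v : A.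
Hypothesis uu : u ^+ 2 = 0.
Hypothesis vv : v ^+ 2 = 0.
Hypothesis uvA : forall a, (phi a * (u * v) == 0) = (a == 0).
Hypothesis annu : forall r, u * r = 0 ->
  exists b d, r = phi b * u + phi d * (u * v).
Variables (n : nat) (a1 a2 a3 a4 : F).
Hypothesis n_gt0 : (0 < n)%N.
Hypothesis a3_neq0 : a3 != 0.
Let alpha := phi a1 + phi a2 * u + phi a3 * v + phi a4 * (u * v).
Local Notation h := ('X^n - alpha%:P).
Local Notation Rx := (constacyclic n alpha).

Definition evq : {poly F} -> Rx := in_qpoly h \o map_poly phi.
HB.instance Definition _ := GRing.RMorphism.on evq.

Lemma evqC a : evq a%:P = (phi a)%:A.
Proof. by rewrite /evq /= map_polyC in_qpolyC. Qed.

Lemma evqX : evq 'X = qpolyX h.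
Proof. by rewrite /evq /= map_polyX. Qed.

Lemma evq_quad a0 : evq ('X^2 - a0%:P) = qpolyX h ^+ 2 - (phi a0)%:A.
Proof. by rewrite (rmorphB evq) (rmorphXn evq) /= evqX evqC. Qed.

Lemma evq_XnsubC :
  evq ('X^n - a1%:P) = (phi a2 * u + phi a3 * v + phi a4 * (u * v))%:A.
Proof.
rewrite (rmorphB evq) /= evqC /evq /= map_polyXn in_qpolyXn // -scalerBl.
by congr (_ *: _); rewrite /alpha; ring.
Qed.

(** Only the [v]-part of [x^n - a1] survives multiplication by [u]. As [a3 != 0], this expresses
    [uv] as [u] times the image of a polynomial over [F]. *)
Lemma u_evq_XnsubC : u *: evq ('X^n - a1%:P) = (phi a3 * (u * v)) *: 1.
Proof.
rewrite evq_XnsubC scalerA; congr (_ *: _).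
apply/eqP; rewrite -subr_eq0; apply/eqP.
by transitivity ((phi a2 + phi a4 * v) * u ^+ 2); [ring | rewrite uu mulr0].
Qed.

Lemma uv_evq_XnsubC a : (a * (u * v)) *: evq ('X^n - a1%:P) = 0.
Proof.
rewrite mulrC [u * v]mulrC mulrAC -scalerA u_evq_XnsubC scalerA.
transitivity ((a * phi a3 * u * v ^+ 2) *: (1 : Rx)); first by congr (_ *: _);
  ring.
by rewrite vv mulr0 scale0r.
Qed.

Lemma u_evq_XnsubC_sqr : u *: evq (('X^n - a1%:P) ^+ 2) = 0.
Proof.
by rewrite expr2 (rmorphM evq) /= scalerAl u_evq_XnsubC -scalerAl mul1r
  uv_evq_XnsubC.
Qed.

(** No reduction occurs below degree [n], and multiplication by [a uv] kills no nonzero element of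
    [F]. *)
Lemma weight_uv_evq (a : F) (f : {poly F}) : a != 0 -> (size f <= n)%N ->
  weight ((phi a * (u * v)) *: evq f : {poly A}) = weight f.
Proof.
move=> a0 fn.
have -> : (phi a * (u * v)) *: evq f = (phi a * (u * v)) *: map_poly phi f :>
  {poly A}.
  rewrite poly_of_qpolyZ; congr (_ *: _); apply: in_qpoly_small.
  by rewrite mk_monic_XnsubC // size_XnsubC // ltnS size_map_poly.
rewrite (@weight_sum _ n); last first.
  by rewrite (leq_trans (size_scale_leq _ _)) // size_map_poly.
rewrite (weight_sum fn); apply: eq_bigr => i _.
by rewrite coefZ coef_map /= mulrAC -rmorphM uvA mulf_eq0 (negPf a0).
Qed.

Lemma uv_evq_mod (f : {poly F}) :
  (phi a3 * (u * v)) *: evq f = (phi a3 * (u * v)) *: evq (f %% ('X^n - a1%:P)).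
Proof.
by rewrite {1}(divp_eq f ('X^n - a1%:P)) (rmorphD evq) (rmorphM evq) /=
  scalerDr scalerAr uv_evq_XnsubC mulr0 add0r.
Qed.

Lemma annihilator_u (c : Rx) : u *: c = 0 -> exists B : {poly F}, c = u *: evq
  B.
Proof.
move=> uc0.
have coefP i : exists bd : F * F, (c : {poly A})`_i = phi bd.1 * u + phi bd.2 *
  (u * v).
  have [|b [d E]] := annu (r := (c : {poly A})`_i); last by exists (b, d).
  by rewrite -coefZ -poly_of_qpolyZ uc0 coef0.
case/choice: coefP => bd bdP.
pose B := \poly_(i < n) (bd i).1; pose D := \poly_(i < n) (bd i).2.
(* By [u_evq_XnsubC], [u] times the second summand is exactly the [uv]-part of [c]. *)
exists (B + (a3^-1)%:P * D * ('X^n - a1%:P)).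
have -> : c = u *: evq B + (u * v) *: evq D.
  rewrite -[LHS](in_qpoly_val) /evq /= -!in_qpolyZ -rmorphD /=; congr in_qpoly.
  apply/polyP => i; rewrite coefD !coefZ !coef_map /= !coef_poly.
  case: ltnP => [_|ni]; first by rewrite bdP ![_ * phi _]mulrC.
  by rewrite rmorph0 !mulr0 addr0 nth_default // (leq_trans (size_constacyclic
    n_gt0 _)).
rewrite (rmorphD evq) !(rmorphM evq) /= scalerDr; congr (_ + _).
rewrite scalerAr u_evq_XnsubC -scalerAr mulr1 evqC mulr_algl scalerA.
by rewrite mulrAC -rmorphM divff // rmorph1 mul1r.
Qed.

Variables (p s : nat) (a0 : F).
Hypothesis pcharF : p \in [pchar F].
Hypothesis nE : n = (2 * p ^ s)%N.
Hypothesis a0E : a0 ^+ (p ^ s) = a1.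
Local Notation Y := ('X^2 - a0%:P : {poly F}).
Variable C : Rx -> Prop.
Hypothesis CM : forall r c, C c -> C (r * c).

Lemma quad_exp_pchar : Y ^+ (p ^ s) = 'X^n - a1%:P.
Proof. by rewrite (XnsubC_exp_pchar pcharF) a0E nE. Qed.

Lemma idealZ k c : C c -> C (k *: c).
Proof. by move=> Cc; rewrite -mulr_algl; apply: CM. Qed.

Lemma ideal_u_power_le k j : (k <= j)%N ->
  C (u *: evq (Y ^+ k)) -> C (u *: evq (Y ^+ j)).
Proof.
move=> kj Ck; rewrite -(subnK kj) exprD (rmorphM evq) /= scalerAr.
exact: CM.
Qed.

Lemma u_evq_quad_exp j :
  u *: evq (Y ^+ (p ^ s + j)) = (phi a3 * (u * v)) *: evq (Y ^+ j).
Proof.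
by rewrite exprD quad_exp_pchar (rmorphM evq) /= scalerAl u_evq_XnsubC
  -scalerAl mul1r.
Qed.

(* [<u>] is a chain of ideals because [x^2 - a0] is irreducible. *)
Lemma ideal_u_power (B : {poly F}) :
  irreducible_poly Y -> B != 0 -> C (u *: evq B) ->
  exists k w, B = Y ^+ k * w /\ C (u *: evq (Y ^+ k)).
Proof.
move=> irrY B0 CB; have Y1 : (1 < size Y)%N by rewrite size_XnsubC.
have [k [w [BE Yw]]] := dvdp_exp_max Y1 B0; exists k, w; split=> //.
(* This power of [Y] is [(x^n - a1)^2], which [u] kills; the Bezout relation therefore inverts [w],
   up to a constant [e], on multiples of [u]. *)
have : coprimep (Y ^+ (p ^ s * 2)) w.
  by rewrite coprimep_expl // irreducible_poly_coprime.
case/Bezout_coprimepP => -[U1 U2] /= /eqpf_eq[e e0 BzE]; rewrite alg_polyC in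
  BzE.
have U2w : U2 * w = e%:P - U1 * ('X^n - a1%:P) ^+ 2.
  by rewrite -BzE exprM quad_exp_pchar addrAC subrr add0r.
have -> : u *: evq (Y ^+ k) = evq (e^-1%:P * U2) * (u *: evq B).
  rewrite -scalerAr -(rmorphM evq) BE.
  have -> : e^-1%:P * U2 * (Y ^+ k * w) =
      Y ^+ k - e^-1%:P * Y ^+ k * U1 * ('X^n - a1%:P) ^+ 2.
    transitivity (e^-1%:P * Y ^+ k * (U2 * w)); first by ring.
    rewrite U2w mulrBr mulrAC -polyCM mulVf // mul1r; congr (_ - _).
    by rewrite !mulrA.
  by rewrite (rmorphB evq) (rmorphM evq) /= scalerBr scalerAr u_evq_XnsubC_sqr
    mulr0 subr0.
exact: CM.
Qed.

Variable I : nat.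
Hypothesis minI : forall k, C (u *: evq (Y ^+ k)) -> (I <= k)%N.

(* Multiplying by [u] if needed puts a codeword in [ann(u) = <u>] without
   increasing its weight; as [I >= p^s], it is then [uv] times a polynomial
   over [F]. *)
Lemma codeword_weight_ge_field c : irreducible_poly Y ->
  (p ^ s <= I <= 2 * p ^ s)%N -> C c -> c != 0 ->
  exists f : {poly F}, [/\ f != 0, (size f <= n)%N, Y ^+ (I - p ^ s) %| f &
    (weight f <= weight (c : {poly A}))%N].
Proof.
move=> irrY /andP[sI Is] Cc c0.
have [d [Cd d0 ud wd]] : exists d : Rx, [/\ C d, d != 0, u *: d = 0 &
    (weight (d : {poly A}) <= weight (c : {poly A}))%N].
  have [uc|uc] := eqVneq (u *: c) 0; first by exists c; split.
  exists (u *: c); split=> //.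
  - exact: idealZ.
  - by rewrite scalerA -expr2 uu scale0r.
  - rewrite poly_of_qpolyZ (leq_trans (weightZ _ _)) //.
    by case: (u != 0); rewrite ?mul0n ?mul1n.
have [B dB] := annihilator_u ud.
have B0 : B != 0 by apply: contraNneq d0 => B0; rewrite dB B0 rmorph0 scaler0.
have [k [w [BE /minI Ik]]] : exists k w, B = Y ^+ k * w /\ C (u *: evq (Y ^+
  k)).
  by apply: ideal_u_power => //; rewrite -dB.
(* Spending [p ^ s] factors [Y] turns [u] into [a3 uv]; the remaining cofactor [E] may then be
   reduced modulo ['X^n - a1%:P]. *)
pose E := Y ^+ (k - p ^ s) * w; pose f := E %% ('X^n - a1%:P).
have dE : d = (phi a3 * (u * v)) *: evq f.
  rewrite -uv_evq_mod dB BE -(subnKC (leq_trans sI Ik)) (rmorphM evq) /=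
    scalerAl.
  by rewrite u_evq_quad_exp /E (rmorphM evq) -scalerAl.
have sf : (size f <= n)%N.
  by rewrite -ltnS -(size_XnsubC a1 n_gt0) ltn_modp -size_poly_gt0 size_XnsubC.
exists f; split=> //.
- by apply: contraNneq d0 => f0; rewrite dE f0 rmorph0 scaler0.
(* The modulus is [Y ^+ (p ^ s)], so reduction preserves divisibility by powers of [Y] up to
   [p ^ s]. *)
- have I2 : (I - p ^ s <= p ^ s)%N by rewrite leq_subLR addnn -mul2n.
  have YE : Y ^+ (I - p ^ s) %| E.
    by rewrite dvdp_mulr // dvdp_exp2l // leq_sub2r.
  rewrite /f -(dvdp_addr _ (_ : Y ^+ (I - p ^ s) %| E %/ ('X^n - a1%:P) * ('X^n
    - a1%:P))).
    by rewrite -divp_eq.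
  by rewrite dvdp_mull // -quad_exp_pchar dvdp_exp2l.
- by move: wd; rewrite dE weight_uv_evq.
Qed.

Lemma hamming_distance_low : (I <= p ^ s)%N -> C (u *: evq (Y ^+ I)) ->
  is_hamming_distance C 1.
Proof.
move=> Is CI; have Cs := ideal_u_power_le Is CI.
have E0 := u_evq_quad_exp 0; rewrite addn0 expr0 in E0.
have w1 : weight ((phi a3 * (u * v)) *: evq 1 : {poly A}) = 1%N.
  rewrite weight_uv_evq // ?size_poly1 //.
  by rewrite /weight polyseq1 /= oner_eq0.
split=> [|c _ c0]; last first.
  by rewrite hamming_weight_codeword // weight_gt0.
exists (u *: evq (Y ^+ (p ^ s))); rewrite E0 in Cs *.
split=> //; last by rewrite hamming_weight_codeword.
have : (0 < weight ((phi a3 * (u * v)) *: evq 1 : {poly A}))%N by rewrite w1.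
by rewrite weight_gt0.
Qed.

Lemma hamming_distance_high G g : irreducible_poly Y -> (I <= 2 * p ^ s)%N ->
  C (u *: evq (Y ^+ I)) -> a0 != 0 -> (g < s)%N -> (G.+1 < p)%N ->
  (2 * p ^ s - p ^ (s - g) + G * p ^ (s - g.+1) < I
    <= 2 * p ^ s - p ^ (s - g) + G.+1 * p ^ (s - g.+1))%N ->
  is_hamming_distance C (G.+2 * p ^ g).
Proof.
move=> irrY I2s CI a0_neq0 gs Gp /andP[TI IT].
have p_gt0 : (0 < p)%N := prime_gt0 (pcharf_prime pcharF).
have psg : (p ^ (s - g) <= p ^ s)%N by rewrite leq_pexp2l // leq_subr.
have split_ps x : (2 * p ^ s - p ^ (s - g) + x = p ^ s + (p ^ s - p ^ (s - g) +
  x))%N.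
  by rewrite mul2n -addnn -addnBA // addnA.
rewrite !split_ps in TI IT.
have sI : (p ^ s <= I)%N by rewrite (leq_trans (leq_addr _ _) (ltnW TI)).
(* [J] is the right end of the range, less [p ^ s]. It is the exponent of [weight_upper_bound] at
   [G.+1], and [I <= p ^ s + J] puts [uv y^J] in [C]. *)
set J := (p ^ s - p ^ (s - g) + G.+1 * p ^ (s - g.+1))%N in IT.
have lower (f : {poly F}) : f != 0 -> (size f <= n)%N -> Y ^+ (I - p ^ s) %| f
  ->
    (G.+2 * p ^ g <= weight f)%N.
  move=> f0 fn Yf.
  apply: (weight_lower_bound_Xn pcharF (c := 2) (s := s) (a := a0) _ _ _ _ Yf)
    => //.
    by rewrite -nE.
  by rewrite ltn_subRL.
have lowerC c : C c -> c != 0 -> (G.+2 * p ^ g <= hamming_weight (codeword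
  c))%N.
  move=> Cc c0; rewrite hamming_weight_codeword //.
  case: (codeword_weight_ge_field irrY _ Cc c0) => [|f [f0 fn Yf]]; first by
    rewrite sI.
  by apply: leq_trans; apply: lower.
split=> //.
(* From [G.+1 < p] follows [J < p ^ s], so [Y ^+ J] needs no reduction. *)
have YJn : (size (Y ^+ J)%R <= n)%N.
  rewrite (leq_trans (size_poly_exp_leq _ _)) // size_XnsubC //= nE ltn_pmul2l
    //.
  rewrite /J -[X in (_ < X)%N](subnK psg) ltn_add2l.
  by rewrite -(subnSK gs) expnS ltn_pmul2r ?expn_gt0 ?p_gt0.
have YJ0 : Y ^+ J != 0 by rewrite expf_neq0 // -size_poly_gt0 size_XnsubC.
have Cc : C ((phi a3 * (u * v)) *: evq (Y ^+ J)).
  by rewrite -u_evq_quad_exp; apply: ideal_u_power_le CI.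
have c0 : (phi a3 * (u * v)) *: evq (Y ^+ J) != 0.
  move: YJ0; rewrite -weight_gt0 -(weight_uv_evq a3_neq0 YJn).
  by rewrite weight_gt0.
exists ((phi a3 * (u * v)) *: evq (Y ^+ J)); split=> //.
apply/eqP; rewrite eqn_leq lowerC // andbT hamming_weight_codeword //.
by rewrite weight_uv_evq // weight_upper_bound.
Qed.

End UVConstacyclic.

(** * Tiling of the exponents by the ranges, and assembly of the theorem *)

Lemma ranges_cover p s j : (1 < p)%N -> (0 < j < p ^ s)%N ->
  exists G g, [/\ (G.+1 < p)%N, (g < s)%N &
    (p ^ s - p ^ (s - g) + G * p ^ (s - g.+1) < j
      <= p ^ s - p ^ (s - g) + G.+1 * p ^ (s - g.+1))%N].
Proof.
move=> p1; elim: s j => [|s IH] j /andP[j0 jp]; first by move: j0 jp; rewrite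
  expn0; lia.
have q0 : (0 < p ^ s)%N by rewrite expn_gt0 ltnW.
(* The ranges with [g = 0] are the first [p - 1] blocks of length [p ^ s], open on the left and
   closed on the right, hence the quotient of [j.-1]. The last block is subdivided recursively. *)
have [jq|qj] := leqP j (p.-1 * p ^ s).
  have [Gle Glt] := (leq_divM j.-1 (p ^ s), ltn_ceil j.-1 q0).
  exists (j.-1 %/ p ^ s)%N, 0%N; rewrite subn0 subnn add0n subSS subn0.
  split=> //; last by apply/andP; split; lia.
  have : (j.-1 %/ p ^ s * p ^ s < p.-1 * p ^ s)%N by lia.
  by rewrite ltn_pmul2r // => ?; lia.
have E : (p ^ s.+1 = p.-1 * p ^ s + p ^ s)%N.
  by rewrite expnS -{1}(prednK (ltnW p1)) mulSn addnC.
rewrite E in jp.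
have [|G [g [Gp gs Hj]]] := IH (j - p.-1 * p ^ s)%N.
  by rewrite subn_gt0 qj ltn_subLR // ltnW.
exists G, g.+1; split=> //; rewrite !subSS E.
have psg : (p ^ (s - g) <= p ^ s)%N by rewrite leq_pexp2l ?(ltnW p1) //
  leq_subr.
move: Hj psg qj.
move: (p.-1 * _)%N (G * _)%N (G.+1 * _)%N => x y z.
move: (p ^ (s - g))%N (p ^ s)%N => w q.
clear; lia.
Qed.

Lemma irreducible_quad (F : fieldType) (a : F) :
  ~ (exists b, b ^+ 2 = a) -> irreducible_poly ('X^2 - a%:P).
Proof.
move=> nsq; apply: cubic_irreducible => [|x]; first by rewrite size_XnsubC.
by rewrite rootE !hornerE subr_eq0; apply/eqP => xa; apply: nsq; exists x.
Qed.

(** Translation by [1] permutes [F]; comparing the sums of all elements shows that the cardinality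
    is zero in [F]. *)
Lemma pchar_card (F : finFieldType) p m :
  prime p -> #|F| = (p ^ m)%N -> p \in [pchar F].
Proof.
move=> p_pr cardF; have : (p ^ m)%:R == 0 :> F.
  have : \sum_(x : F) (x + 1) = \sum_(x : F) x.
    by apply/esym/(reindex_inj (addIr 1)).
  rewrite big_split /= sumr_const cardF => /eqP.
  by rewrite -subr_eq0 addrAC subrr add0r.
rewrite natrX expf_eq0 => /andP[_ p0].
by rewrite inE p_pr.
Qed.

Theorem theorem4p3 (p m s : nat) (F : finFieldType)
    (a1 a2 a3 a4 a0 : F) (l t I : nat)
    (z : constacyclic (2 * p ^ s)%N (uvElt a1 a2 a3 a4)) :
  let n := (2 * p ^ s)%N in
  let alpha : uvRing F := uvElt a1 a2 a3 a4 in
  let y : constacyclic n alpha := quadC n alpha a0 in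
  let C : constacyclic n alpha -> Prop :=
    principal_ideal (y ^+ l + uvU F *: (y ^+ t * z)) in
  prime p -> odd p -> (0 < m)%N -> (0 < s)%N -> #|F| = (p ^ m)%N ->
  a1 != 0 -> a2 != 0 -> a3 != 0 ->
  ~ (exists b : uvRing F, b ^+ 2 = alpha) ->
  a0 ^+ (p ^ s) = a1 ->
  (0 <= l <= 2 * p ^ s - 1)%N -> (0 <= t < l)%N ->
  zero_or_unit n alpha a0 z ->
  C (uvU F *: y ^+ I) ->
  (forall k : nat, C (uvU F *: y ^+ k) -> (I <= k)%N) ->
  let in_range (G g : nat) : Prop :=
    [/\ (1 <= G <= p - 1)%N, (0 <= g <= s - 1)%N &
        (2 * p ^ s - p ^ (s - g) + (G - 1) * p ^ (s - g - 1) + 1 <= I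
          <= 2 * p ^ s - p ^ (s - g) + G * p ^ (s - g - 1))%N] in
  [/\ (0 <= I <= p ^ s)%N -> is_hamming_distance C 1%N,
      forall G g : nat, in_range G g ->
        is_hamming_distance C ((G + 1) * p ^ g)%N &
      (0 <= I <= p ^ s)%N \/ exists G g : nat, in_range G g].
Proof.
move=> n alpha y C p_pr p_odd _ s0 cardF a10 a20 a30 nsq a0E /andP[_ ln] _ _ CI
  minI in_range.
have pcharF := pchar_card p_pr cardF.
have p_gt1 := prime_gt1 p_pr.
have n_gt0 : (0 < n)%N by rewrite /n muln_gt0 expn_gt0 (prime_gt0 p_pr).
have two0 : 2%:R != 0 :> F.
  by rewrite -(dvdn_pcharf pcharF) gtnNdvd // odd_gt2.
have irrY : irreducible_poly ('X^2 - a0%:P : {poly F}).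
  (* A square root [e] of [a0] makes [a1] the square of [e ^+ (p ^ s)], which lifts to a square root
     of [alpha]. *)
  apply: irreducible_quad => -[e e2]; apply: nsq.
  have a1E : a1 = (e ^+ (p ^ s)) ^+ 2 by rewrite -a0E -e2 exprAC.
  rewrite /alpha a1E; apply: uvElt_sqr => //.
  by apply: contraNneq a10 => e0; rewrite a1E e0 expr0n.
have a0_neq0 : a0 != 0.
  by apply: contraNneq a10 => a00; rewrite -a0E a00 expr0n expn_eq0 -leqn0
    leqNgt prime_gt0.
have CM r c : C c -> C (r * c).
  by case=> r' ->; exists (r * r'); rewrite mulrA.
pose ev : {rmorphism {poly F} -> constacyclic n alpha} :=
  @evq F (uvRing F) (@uvC F) (uvU F) (uvV F) n a1 a2 a3 a4.
have yE k : y ^+ k = ev (('X^2 - a0%:P) ^+ k).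
  by rewrite (rmorphXn ev) /= evq_quad.
rewrite yE in CI.
have minI' k : C (uvU F *: ev (('X^2 - a0%:P) ^+ k)) -> (I <= k)%N.
  by rewrite -yE; apply: minI.
have Il : (I <= l)%N.
  (* [u] times the generator is [u y^l], because [u^2 = 0] kills the other summand. *)
  apply: minI; exists (uvU F)%:A; rewrite mulr_algl scalerDr scalerA.
  by rewrite -expr2 uvU_sqr scale0r addr0.
have I2s : (I < 2 * p ^ s)%N.
  by rewrite (leq_ltn_trans (leq_trans Il ln)) // subn1 ltn_predL.
have low Is := hamming_distance_low (uvU_sqr F) (@uvC_UV_eq0 F) n_gt0 a30 pcharF
  erefl a0E CM Is CI.
have high G g := @hamming_distance_high _ _ _ _ _ (uvU_sqr F) (uvV_sqr F)
  (@uvC_UV_eq0 F) (@annihilator_uvU F) _ _ _ _ _ n_gt0 a30 _ _ _ pcharF erefl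
    a0E
  _ CM _ minI' G g irrY (ltnW I2s) CI a0_neq0.
split.
- exact: low.
- move=> [|G] g [/andP[// _ Gp] /andP[_ gs]].
  rewrite !addn1 subn1 /= -subnDA addn1 => HI.
  by apply: high => //; [rewrite -(subnK s0) addn1 ltnS | rewrite -(subnK (ltnW
    p_gt1)) addn1 ltnS].
- case: (leqP I (p ^ s)) => [|sI]; [by left | right].
  (* The ranges for [I] are those of [ranges_cover] shifted by [p ^ s], with [G.+1] as [Gamma]. *)
  have [|G [g [Gp gs HI]]] := @ranges_cover p s (I - p ^ s) p_gt1.
    by rewrite subn_gt0 sI ltn_subLR ?(ltnW sI) // addnn -mul2n.
  exists G.+1, g; split; first by rewrite ltn_subRL.
    by rewrite leq_subRL // add1n.
  have psg : (p ^ (s - g) <= p ^ s)%N by rewrite leq_pexp2l ?(ltnW p_gt1) //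
    leq_subr.
  rewrite subn1 /= -subnDA !addn1.
  move: HI sI psg; move: (G * _)%N (G.+1 * _)%N => v w.
  move: (p ^ (s - g))%N (p ^ s)%N => x q; clear; lia.
Qed.
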